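(* Let $(X,o)$ be an irreducible germ of a complex analytic space, let $\mathcal{I}=(h)$ be a principal ideal in $\mathcal{O}_{X,o}$ with $h\neq 0$, and let $V$ be the analytic subspace of $(X,o)$ determined by $\mathcal{I}$. Let $\underline{\nu}=\{\nu_1,\ldots,\nu_r\}$ be a set of discrete valuations of $\mathbb{C}(X)$ centred at the maximal ideal of $\mathcal{O}_{X,o}$, and write $\underline{q}=\underline{\nu}(h)=(\nu_1(h),\ldots,\nu_r(h))$. Then $$\mathcal{P}^{\underline{\nu}}_{V}(\underline{t})=(1-\underline{t}^{\underline{q}})\,P^{\underline{\nu}}_X(\underline{t}).$$
   Context: $\mathcal{O}_{X,o}$ is the local ring of germs of holomorphic functions on $(X,o)$ and $\mathbb{C}(X)$ is its field of fractions. A valuation centred at the maximal ideal is nonnegative on $\mathcal{O}_{X,o}$ and strictly positive exactly on the maximal ideal. For $\underline{v}\in\mathbb{Z}^r$ put $$M(\underline{v})=\{g\in\mathcal{O}_{X,o}\mid \nu_j(g)\ge v_j,\ 1\le j\le r\},$$ and let $I(\underline{v})$ be the image of $M(\underline{v})+\mathcal{I}$ under the quotient map $\varphi:\mathcal{O}_{X,o}\to\mathcal{O}_{V,o}=\mathcal{O}_{X,o}/\mathcal{I}$. Write $\underline{t}^{\underline{v}}=t_1^{v_1}\cdots t_r^{v_r}$ and $\underline{1}=(1,\ldots,1)$. The Poincaré series of the filtration $\{M(\underline v)\}$ is $$P^{\underline{\nu}}_{X}(\underline t)=\frac{\prod_{j=1}^{r}(t_j-1)}{t_1\cdots t_r-1}\sum_{\underline{v}\in\mathbb{Z}^r}\dim_{\mathbb{C}}\bigl(M(\underline{v})/M(\underline{v}+\underline{1})\bigr)\,\underline{t}^{\underline{v}},$$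 and the Poincaré series of the embedded filtration $\{I(\underline v)\}$ is $$\mathcal{P}^{\underline{\nu}}_{V}(\underline t)=\frac{\prod_{j=1}^{r}(t_j-1)}{t_1\cdots t_r-1}\sum_{\underline{v}\in\mathbb{Z}^r}\dim_{\mathbb{C}}\bigl(I(\underline{v})/I(\underline{v}+\underline{1})\bigr)\,\underline{t}^{\underline{v}}.$$ In both cases the sum over $\mathbb{Z}^r$ is first multiplied by $\prod_j(t_j-1)$, which gives a formal power series in $t_1,\ldots,t_r$, and this is then divided by $t_1\cdots t_r-1$ in $\mathbb{Z}[[t_1,\ldots,t_r]]$. *)

(* Defs.v *)
(* constructive_ereal can be loaded after mpoly but not before it (the levels of
   their notations clash). *)
From HB Require Import structures.
From mathcomp Require Import all_boot all_order all_algebra.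
From mathcomp Require Import generic_quotient ring_quotient fraction.
From mathcomp Require Import mpoly.
From mathcomp Require Import boolp classical_sets constructive_ereal.

Set Implicit Arguments.
Unset Strict Implicit.
Unset Printing Implicit Defensive.

Import Order.TTheory GRing.Theory Num.Theory.

Local Open Scope classical_set_scope.
Local Open Scope quotient_scope.
Local Open Scope ring_scope.

Section ClassicalInverse.
Variable A : comNzRingType.

Definition has_inv (x : A) : bool := `[< exists y, y * x = 1 >].

Definition classical_inv (x : A) : A :=
  if pselect (exists y, y * x = 1) is left e then projT1 (cid e) else x.

Lemma classical_mulVx : {in has_inv, left_inverse 1 classical_inv *%R}.
Proof.
move=> x /asboolP hx; rewrite /classical_inv; case: pselect => // e.
by case: (cid e).
Qed.

Lemma has_invPl (x y : A) : y * x = 1 -> has_inv x.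
Proof. by move=> e; apply/asboolP; exists y. Qed.

Lemma classical_inv_out : {in [predC has_inv], classical_inv =1 id}.
Proof.
move=> x; rewrite inE => /asboolP hx; rewrite /classical_inv.
by case: pselect.
Qed.

End ClassicalInverse.

(* R[[x_1,...,x_n]]; a record, so that the pointwise operations on functions do
   not interfere. *)
Record fps (n : nat) (R : Type) := FPS { fcoef :> 'X_{1..n} -> R }.

HB.instance Definition _ n R := gen_eqMixin (fps n R).
HB.instance Definition _ n R := gen_choiceMixin (fps n R).

Lemma fpsP n R (f g : fps n R) : f =1 g <-> f = g.
Proof.
split=> [|-> //]; case: f g => [f] [g] /= h; congr FPS; exact/funext.
Qed.

Section FpsZmod.
Variables (n : nat) (R : zmodType).
Implicit Types f g : fps n R.

Definition fps0 : fps n R := FPS (fun=> 0).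
Definition fps_opp f : fps n R := FPS (fun m => - f m).
Definition fps_add f g : fps n R := FPS (fun m => f m + g m).

Lemma fps_addA : associative fps_add.
Proof. by move=> f g h; apply/fpsP => m /=; rewrite addrA. Qed.
Lemma fps_addC : commutative fps_add.
Proof. by move=> f g; apply/fpsP => m /=; rewrite addrC. Qed.
Lemma fps_add0 : left_id fps0 fps_add.
Proof. by move=> f; apply/fpsP => m /=; rewrite add0r. Qed.
Lemma fps_addN : left_inverse fps0 fps_opp fps_add.
Proof. by move=> f; apply/fpsP => m /=; rewrite addNr. Qed.

HB.instance Definition _ :=
  GRing.isZmodule.Build (fps n R) fps_addA fps_addC fps_add0 fps_addN.

Lemma fpsDE f g m : (f + g) m = f m + g m. Proof. by []. Qed.
Lemma fpsNE f m : (- f) m = - f m. Proof. by []. Qed.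
Lemma fps0E m : (0 : fps n R) m = 0. Proof. by []. Qed.
End FpsZmod.

Section FpsRing.
Variables (n : nat) (R : comNzRingType).
Implicit Types f g : fps n R.

Definition fps_of_mpoly (p : {mpoly R[n]}) : fps n R := FPS (fun m => p@_m).

Definition fps_mul f g : fps n R := FPS (fun m =>
  \sum_(k : 'X_{1..n < (mdeg m).+1, (mdeg m).+1} | m == (k.1 + k.2)%MM)
     f k.1 * g k.2).

Definition fps_trunc (d : nat) f : {mpoly R[n]} :=
  \sum_(m : 'X_{1..n < d}) f m *: 'X_[m].

Lemma mcoeff_trunc d f m : (fps_trunc d f)@_m = if (mdeg m < d)%N then f m else 0.
Proof.
rewrite /fps_trunc raddf_sum /=; case: ifPn => hm.
  rewrite (bigD1 (BMultinom hm)) //= mcoeffZ mcoeffX eqxx mulr1.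
  rewrite big1 ?addr0 // => k kN; rewrite mcoeffZ mcoeffX.
  case: eqP => [e|]; last by rewrite mulr0.
  by case/eqP: kN; apply/val_inj.
rewrite big1 // => k _; rewrite mcoeffZ mcoeffX; case: eqP => [e|]; last by rewrite mulr0.
by case/negP: hm; rewrite -e bmdeg.
Qed.

Lemma fps_mul_mpoly f g (p q : {mpoly R[n]}) m :
    (forall k, (mdeg k <= mdeg m)%N -> p@_k = f k) ->
    (forall k, (mdeg k <= mdeg m)%N -> q@_k = g k) ->
  fps_mul f g m = (p * q)@_m.
Proof.
move=> hp hq; rewrite mcoeffM; apply: eq_bigr => -[k1 k2] /= _.
by rewrite hp ?hq // -ltnS bmdeg.
Qed.

Lemma fps_mulE d f g m : (mdeg m < d)%N ->
  fps_mul f g m = (fps_trunc d f * fps_trunc d g)@_m.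
Proof.
by move=> hm; apply: fps_mul_mpoly => k hk; rewrite mcoeff_trunc (leq_ltn_trans hk hm).
Qed.

Lemma fps_mulC : commutative fps_mul.
Proof.
move=> f g; apply/fpsP => m.
by rewrite !(@fps_mulE (mdeg m).+1) // mulrC.
Qed.

Lemma fps_mulA : associative fps_mul.
Proof.
move=> f g h; apply/fpsP => m; pose d := (mdeg m).+1.
pose T := fps_trunc d.
have hT u k : (mdeg k <= mdeg m)%N -> (T u)@_k = u k.
  by move=> hk; rewrite mcoeff_trunc ltnS hk.
rewrite (@fps_mul_mpoly _ _ (T f) (T g * T h)); first last.
- by move=> k hk; rewrite (@fps_mulE d) ?ltnS.
- exact: hT.
rewrite (@fps_mul_mpoly _ _ (T f * T g) (T h)); first by rewrite mulrA.
- by move=> k hk; rewrite (@fps_mulE d) ?ltnS.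
- exact: hT.
Qed.

Definition fps1 : fps n R := fps_of_mpoly 1.

Lemma fps_mul1 : left_id fps1 fps_mul.
Proof.
move=> f; apply/fpsP => m.
rewrite (@fps_mul_mpoly _ _ 1 (fps_trunc (mdeg m).+1 f)) // => [|k hk].
  by rewrite mul1r mcoeff_trunc ltnSn.
by rewrite mcoeff_trunc ltnS hk.
Qed.

Lemma fps_mulDl : left_distributive fps_mul +%R.
Proof.
move=> f g h; apply/fpsP => m; rewrite fpsDE /= -big_split /=.
by apply: eq_bigr => k _; rewrite mulrDl.
Qed.

Lemma fps_1N0 : fps1 != 0.
Proof.
apply/eqP => /fpsP /(_ 0%MM) /=; rewrite mcoeff1 eqxx => /eqP.
by rewrite oner_eq0.
Qed.

HB.instance Definition _ := GRing.Zmodule_isComNzRing.Build (fps n R)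
  fps_mulA fps_mulC fps_mul1 fps_mulDl fps_1N0.

Lemma fpsME f g m : (f * g) m =
  \sum_(k : 'X_{1..n < (mdeg m).+1, (mdeg m).+1} | m == (k.1 + k.2)%MM)
     f k.1 * g k.2.
Proof. by []. Qed.

HB.instance Definition _ := GRing.ComNzRing_hasMulInverse.Build (fps n R)
  (@classical_mulVx (fps n R)) (@has_invPl (fps n R))
  (@classical_inv_out (fps n R)).

Definition fps_scale (a : R) f : fps n R := FPS (fun m => a * f m).

Lemma fps_scaleA a b f : fps_scale a (fps_scale b f) = fps_scale (a * b) f.
Proof. by apply/fpsP => m /=; rewrite mulrA. Qed.
Lemma fps_scale1 : left_id 1 fps_scale.
Proof. by move=> f; apply/fpsP => m /=; rewrite mul1r. Qed.
Lemma fps_scaleDr : right_distributive fps_scale +%R.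
Proof. by move=> a f g; apply/fpsP => m /=; rewrite mulrDr. Qed.
Lemma fps_scaleDl f : {morph fps_scale^~ f : a b / a + b}.
Proof. by move=> a b; apply/fpsP => m /=; rewrite mulrDl. Qed.

HB.instance Definition _ := GRing.Zmodule_isLmodule.Build R (fps n R)
  fps_scaleA fps_scale1 fps_scaleDr fps_scaleDl.

Lemma fpsZE (a : R) f m : (a *: f) m = a * f m. Proof. by []. Qed.

Lemma fps_scaleAl (a : R) f g : a *: (f * g) = a *: f * g.
Proof.
apply/fpsP => m; rewrite fpsZE !fpsME mulr_sumr.
by apply: eq_bigr => k _; rewrite mulrA.
Qed.

HB.instance Definition _ := GRing.Lmodule_isLalgebra.Build R (fps n R) fps_scaleAl.
HB.instance Definition _ := GRing.Lalgebra_isComAlgebra.Build R (fps n R).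

End FpsRing.

Section Convergent.
Variables (n : nat) (C : numFieldType).
Implicit Types f g : fps n C.

(* Absolute convergence on some polydisc: the partial sums of
   \sum_m |f_m| rho^|m| are bounded for some rho > 0.  When C = R[i], the
   inequalities below force rho and B to be real. *)
Definition psum (rho : C) (d : nat) f : C :=
  \sum_(m : 'X_{1..n < d}) `|f m| * rho ^+ mdeg m.

Definition convergent : {pred fps n C} := fun f =>
  `[< exists2 rho : C, 0 < rho & exists B : C, forall d, psum rho d f <= B >].

Lemma psum_ge0 rho d f : 0 <= rho -> 0 <= psum rho d f.
Proof. by move=> h; apply: sumr_ge0 => m _; rewrite mulr_ge0 ?exprn_ge0. Qed.

Lemma le_psum rho rho' d f : 0 <= rho -> rho <= rho' -> psum rho d f <= psum rho' d f.
Proof.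
move=> h hh; apply: ler_sum => m _; rewrite ler_wpM2l //.
by rewrite lerXn2r // nnegrE // (le_trans h).
Qed.

Lemma psumD rho d f g : 0 <= rho -> psum rho d (f + g) <= psum rho d f + psum rho d g.
Proof.
move=> h; rewrite -big_split /=; apply: ler_sum => m _.
by rewrite -mulrDl ler_wpM2r ?exprn_ge0 ?ler_normD.
Qed.

Lemma psumZ rho d a f : psum rho d (a *: f) = `|a| * psum rho d f.
Proof.
rewrite /psum mulr_sumr; apply: eq_bigr => m _.
by rewrite fpsZE normrM mulrA.
Qed.

Let meval1_ge0 (P : {mpoly C[n]}) : (forall m, 0 <= P@_m) -> 0 <= P.@[fun=> 1].
Proof.
move=> h; rewrite mevalE sumr_ge0 // => m _; rewrite mulr_ge0 // prodr_ge0 // => i _.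
by rewrite expr1n.
Qed.

Let meval1_trunc d (f : fps n C) :
  (fps_trunc d f).@[fun=> 1] = \sum_(m : 'X_{1..n < d}) f m.
Proof.
rewrite /fps_trunc raddf_sum /=; apply: eq_bigr => m _.
by rewrite mevalZ mevalX big1 ?mulr1 // => i _; rewrite expr1n.
Qed.

Lemma psumM rho d f g : 0 <= rho -> psum rho d (f * g) <= psum rho d f * psum rho d g.
Proof.
move=> h; pose N (u : fps n C) : fps n C := FPS (fun m => `|u m| * rho ^+ mdeg m).
have N0 u m : 0 <= N u m by rewrite /= mulr_ge0 ?exprn_ge0.
rewrite -[psum rho d f](meval1_trunc d (N f)) -[psum rho d g](meval1_trunc d (N g)).
rewrite -mevalM; set P : {mpoly C[n]} := (fps_trunc d _ * _).
have P0 m : 0 <= P@_m.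
  rewrite /P mcoeffM sumr_ge0 // => k _; rewrite !mcoeff_trunc.
  by apply: mulr_ge0; case: ifP.
apply: (@le_trans _ _ (fps_trunc d (fps_of_mpoly P)).@[fun=> 1]); last first.
  rewrite -subr_ge0 -mevalB; apply: meval1_ge0 => m.
  by rewrite mcoeffB mcoeff_trunc /=; case: ifP; rewrite ?subrr ?subr0.
rewrite meval1_trunc; apply: ler_sum => m _ /=.
have -> : P@_m = fps_mul (N f) (N g) m by rewrite (@fps_mulE _ _ d) ?bmdeg.
rewrite fpsME /fps_mul /=.
apply: le_trans (_ : \sum_(k : 'X_{1..n < (mdeg m).+1, (mdeg m).+1} | m == (k.1 + k.2)%MM :> 'X_{1..n})
   `|f k.1 * g k.2| * rho ^+ mdeg m <= _).
  by rewrite -mulr_suml ler_wpM2r ?exprn_ge0 ?ler_norm_sum.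
apply: ler_sum => k /eqP e.
by rewrite normrM [X in rho ^+ X](congr1 (@mdeg n) e) mdegD exprD mulrACA.
Qed.

Lemma convergentP f :
  reflect (exists2 rho : C, 0 < rho & exists B : C, forall d, psum rho d f <= B)
    (f \in convergent).
Proof. exact: asboolP. Qed.

Lemma convergent_common f g : f \in convergent -> g \in convergent ->
  exists rho B B' : C, [/\ 0 < rho, forall d, psum rho d f <= B
    & forall d, psum rho d g <= B'].
Proof.
move=> /convergentP[rho r0 [B hB]] /convergentP[rho' r0' [B' hB']].
have hc : rho \is Num.real /\ rho' \is Num.real by rewrite !gtr0_real.
case: (real_leP hc.1 hc.2) => [h|/ltW h].
- exists rho, B, B'; split=> // d; apply: le_trans (hB' d); exact/le_psum/h/ltW.
- exists rho', B, B'; split=> // d; apply: le_trans (hB d); exact/le_psum/h/ltW.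
Qed.

Lemma convergent_subalg : GRing.subalg_closed convergent.
Proof.
have cM : {in convergent &, forall f g, f * g \in convergent}.
  move=> f g cf cg; have [rho [B [B' [r0 hB hB']]]] := convergent_common cf cg.
  apply/convergentP; exists rho => //; exists (B * B') => d.
  apply: le_trans (psumM _ _ _ (ltW r0)) _.
  by apply: ler_pM => //; apply/psum_ge0/ltW.
split=> //.
- apply/convergentP; exists 1; [exact: ltr01|exists 1 => d].
  rewrite /psum; case: d => [|d].
    by rewrite big1 // => -[m hm].
  have h0 : (mdeg (0%MM : 'X_{1..n}) < d.+1)%N by rewrite mdeg0.
  rewrite (bigD1 (BMultinom h0)) //= mcoeff1 eqxx normr1 mul1r expr1n big1 ?addr0 //.
  move=> m mN; rewrite expr1n mulr1 mcoeff1; case: eqP => [e|]; last by rewrite normr0.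
  by case/eqP: mN; apply/val_inj.
- move=> a f g cf cg; have [rho [B [B' [r0 hB hB']]]] := convergent_common cf cg.
  apply/convergentP; exists rho => //; exists (`|a| * B + B') => d.
  apply: le_trans (psumD _ _ _ (ltW r0)) _.
  by rewrite psumZ lerD // ler_wpM2l.
Qed.

HB.instance Definition _ := GRing.isSubalgClosed.Build C (fps n C) convergent
  convergent_subalg.

End Convergent.

Section ConvergentPowerSeries.
Variables (n : nat) (C : numFieldType).

(* C{x_1,...,x_n}: for C the complex numbers, the local ring at 0 of germs of
   holomorphic functions on C^n. *)
Record cps := CPS { cps_val :> fps n C; _ : cps_val \in @convergent n C }.

HB.instance Definition _ := [isSub for cps_val].
HB.instance Definition _ := [Choice of cps by <:].
HB.instance Definition _ := [SubChoice_isSubComNzRing of cps by <:].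
HB.instance Definition _ := [SubZmodule_isSubLmodule of cps by <:].
HB.instance Definition _ := [SubNzRing_SubLmodule_isSubLalgebra of cps by <:].
HB.instance Definition _ := GRing.Lalgebra_isComAlgebra.Build C cps.

End ConvergentPowerSeries.

Section AlgebraQuotient.
Variables (K : comNzRingType) (A : comAlgType K) (I : zmodClosed A).
Hypothesis I_mul : forall a u : A, u \in I -> a * u \in I.

Definition quot_scale (c : K) (x : {ideal_quot I}) : {ideal_quot I} :=
  \pi_({ideal_quot I}) (c *: repr x).

Lemma pi_quot_scale c (a : A) :
  quot_scale c (\pi_({ideal_quot I}) a) = \pi_({ideal_quot I}) (c *: a).
Proof.
apply/eqP; rewrite /quot_scale -Quotient.idealrBE -scalerBr -mulr_algl I_mul //.
by rewrite Quotient.idealrBE reprK.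
Qed.

Lemma quot_scaleA c d x : quot_scale c (quot_scale d x) = quot_scale (c * d) x.
Proof. by elim/quotW: x => x; rewrite (pi_quot_scale d) !(pi_quot_scale _ (_ *: _)) pi_quot_scale scalerA. Qed.

Lemma quot_scale1 : left_id 1 quot_scale.
Proof. by elim/quotW => x; rewrite !pi_quot_scale scale1r. Qed.

Lemma quot_scaleDr : right_distributive quot_scale +%R.
Proof.
move=> c; elim/quotW => x; elim/quotW => y.
by rewrite -raddfD !pi_quot_scale scalerDr raddfD.
Qed.

Lemma quot_scaleDl x : {morph quot_scale^~ x : a b / a + b}.
Proof. by move=> a b; elim/quotW: x => x; rewrite !pi_quot_scale scalerDl raddfD. Qed.

End AlgebraQuotient.

Section Germ.
Variables (n : nat) (C : numFieldType) (J : prime_idealr (cps n C)).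

(* The local ring O_{X,o} of the irreducible germ (X,o) in (C^n,0) defined by the
   prime ideal J. *)
Definition germ_ring := {ideal_quot J}.

HB.instance Definition _ := GRing.ComNzRing.on germ_ring.
HB.instance Definition _ := GRing.ComNzRing_hasMulInverse.Build germ_ring
  (@classical_mulVx germ_ring) (@has_invPl germ_ring)
  (@classical_inv_out germ_ring).
HB.instance Definition _ := GRing.ComUnitRing_isIntegral.Build germ_ring
  (@Quotient.rquot_IdomainAxiom _ J).

Let J_mul (a u : cps n C) : u \in J -> a * u \in J.
Proof. exact: idealMr. Qed.

HB.instance Definition _ := GRing.Zmodule_isLmodule.Build C germ_ring
  (quot_scaleA J_mul) (quot_scale1 J_mul) (quot_scaleDr J_mul) (quot_scaleDl J_mul).

Lemma germ_scaleAl (c : C) (x y : germ_ring) : c *: (x * y) = c *: x * y.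
Proof.
have E (a : cps n C) : c *: (\pi_({ideal_quot J}) a : germ_ring)
                       = \pi_({ideal_quot J}) (c *: a) := pi_quot_scale J_mul c a.
elim/quotW: x => x; elim/quotW: y => y.
have piM a b : (\pi_({ideal_quot J}) a : germ_ring) * \pi_({ideal_quot J}) b
             = \pi_({ideal_quot J}) (a * b) by rewrite rmorphM.
by rewrite (piM x y) (E (x * y)) (E x) scalerAl (piM (c *: x) y).
Qed.

HB.instance Definition _ := GRing.Lmodule_isLalgebra.Build C germ_ring germ_scaleAl.
HB.instance Definition _ := GRing.Lalgebra_isComAlgebra.Build C germ_ring.

End Germ.

Section PrincipalQuotient.
Variables (K : comNzRingType) (A : comAlgType K) (h : A).

Definition principal_ideal : {pred A} := fun g => `[< exists a, g = a * h >].

Lemma principal_idealB : GRing.zmod_closed principal_ideal.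
Proof.
split=> [|u v /asboolP[a ->] /asboolP[b ->]]; apply/asboolP.
  by exists 0; rewrite mul0r.
by exists (a - b); rewrite mulrBl.
Qed.

HB.instance Definition _ := GRing.isZmodClosed.Build A principal_ideal principal_idealB.

Lemma principal_idealMl (a u : A) : u \in principal_ideal -> a * u \in principal_ideal.
Proof. by move=> /asboolP[b ->]; apply/asboolP; exists (a * b); rewrite mulrA. Qed.

(* A/(h); this is the zero space when h is a unit. *)
Definition principal_quot := {ideal_quot principal_ideal}.

HB.instance Definition _ := GRing.Zmodule.on principal_quot.
HB.instance Definition _ := GRing.Zmodule_isLmodule.Build K principal_quot
  (quot_scaleA principal_idealMl) (quot_scale1 principal_idealMl)
  (quot_scaleDr principal_idealMl) (quot_scaleDl principal_idealMl).

Definition quot_map (g : A) : principal_quot := \pi_({ideal_quot principal_ideal}) g.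

End PrincipalQuotient.

Section Dimension.
Variables (K : nzRingType) (E : lmodType K).

Definition quot_basis (M N : set E) (d : nat) (e : 'I_d -> E) : Prop :=
  [/\ forall i, M (e i),
      forall c : 'I_d -> K, N (\sum_(i < d) c i *: e i) -> forall i, c i = 0
    & forall x, M x -> exists c : 'I_d -> K, N (x - \sum_(i < d) c i *: e i)].

(* dim_K (M / N) for subspaces N of M; the default value 0 is used only when
   M / N is infinite-dimensional. *)
Definition quot_dim (M N : set E) : nat :=
  xget 0%N [set d | exists e : 'I_d -> E, quot_basis M N e].

End Dimension.

(* The value group is a nonzero subgroup of Z, not necessarily Z itself. *)
Record discrete_valuation (F : fieldType) := DiscreteValuation {
  dval :> F -> \bar int;
  dval0 : dval 0 = +oo%E;
  dval_fin : forall x, x != 0 -> dval x \is a fin_num;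
  dvalM : forall x y, dval (x * y) = (dval x + dval y)%E;
  dvalD : forall x y, (Order.min (dval x) (dval y) <= dval (x + y))%E;
  dval_nontrivial : exists2 x, x != 0 & dval x != 0%E }.

Section Valuations.

(* The maximal ideal of a local ring A. *)
Definition maximal_ideal (A : unitRingType) : set A :=
  [set g | g \isn't a GRing.unit].

Variable A : idomainType.
Local Notation "g %:F" := (@FracField.tofrac A g).

Definition centred_at_maximal_ideal (nu : discrete_valuation {fraction A}) : Prop :=
  (forall g : A, (0 <= nu g%:F)%E) /\
  (forall g : A, (0 < nu g%:F)%E <-> maximal_ideal g).

Variables (r : nat) (nu : 'I_r -> discrete_valuation {fraction A}).

Definition valuation_filtration (v : 'I_r -> int) : set A :=
  [set g | forall j, ((v j)%:E <= nu j g%:F)%E].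

(* The exponents are natural numbers when the nu j are nonnegative on A and g is
   nonzero. *)
Definition valuation_exponent (g : A) : 'X_{1..r} :=
  [multinom `|fine (nu j g%:F)|%N | j < r].

End Valuations.

Section EmbeddedFiltration.
Variables (n : nat) (C : numFieldType) (J : prime_idealr (cps n C)).
Variables (r : nat) (nu : 'I_r -> discrete_valuation {fraction germ_ring J}).
Variable h : germ_ring J.

Definition embedded_filtration (v : 'I_r -> int) : set (principal_quot h) :=
  quot_map h @` [set g + a | g in valuation_filtration nu v & a in [set` principal_ideal h]].

End EmbeddedFiltration.

Arguments embedded_filtration {n C J r} nu h v.

Section PoincareSeries.
Variable r : nat.

(* Formal sums over Z^r, as coefficient functions, form a module over Z[t_1,...,t_r]. *)
Definition bilateral_scale (p : {mpoly int[r]}) (L : ('I_r -> int) -> int)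
    (v : 'I_r -> int) : int :=
  \sum_(m <- msupp p) p@_m * L (fun j => v j - (m j)%:Z).

Variables (K : nzRingType) (E : lmodType K) (F : ('I_r -> int) -> set E).

Definition dim_series (v : 'I_r -> int) : int :=
  (quot_dim (F v) (F (fun j => v j + 1)))%:Z.

(* The numerator is the product of \prod_j (t_j - 1) with the sum over Z^r: for the
   filtrations considered here its coefficients outside N^r vanish.  For r > 0 the
   denominator is invertible in Z[[t_1,...,t_r]]. *)
Definition poincare_series : fps r int :=
  FPS (fun m : 'X_{1..r} =>
         bilateral_scale (\prod_(j < r) ('X_j - 1)) dim_series (fun j => (m j)%:Z))
  / fps_of_mpoly (\prod_(j < r) 'X_j - 1).

End PoincareSeries.

(* Main.v *)
(* Write l(v) for the codimension of M(v) in the local ring O of X; it is finite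
   because every germ is a constant plus a combination of the coordinates x_i, and
   each x_i, being a nonunit, has valuation at least 1.  Since nu_j(g h) =
   nu_j(g) + q_j, multiplication by h identifies O / M(v - q) with
   (M(v) + (h)) / M(v), so I(v) has codimension l(v) - l(v - q) in O / (h).  Hence
   the two bilateral series satisfy D_V(v) = D_X(v) - D_X(v - q) for all v.  As
   M(v) only depends on the positive parts of the v_j, the numerator of P_X has no
   coefficients outside N^r, and the identity passes to power series. *)
Require Import Defs.
From HB Require Import structures.
From mathcomp Require Import all_boot all_order all_algebra.
From mathcomp Require Import generic_quotient ring_quotient fraction complex.
From mathcomp Require Import ssrcomplements mpoly.
From mathcomp Require Import boolp classical_sets constructive_ereal reals.
From mathcomp Require Import zify.

Set Implicit Arguments.
Unset Strict Implicit.
Unset Printing Implicit Defensive.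

Import Order.TTheory GRing.Theory Num.Theory.
Local Open Scope classical_set_scope.
Local Open Scope ring_scope.

(** * Dimension and bases of quotients of subspaces *)

Section QuotientDimension.
Variables (K : fieldType) (E : lmodType K).
Implicit Types M N L : set E.

Definition subspace N :=
  N 0 /\ forall (a : K) u v, N u -> N v -> N (a *: u + v).

Definition spans_mod M N (I : finType) (g : I -> E) :=
  forall x, M x -> exists c : I -> K, N (x - \sum_i c i *: g i).

Definition finite_dim_mod M N := exists (I : finType) (g : I -> E), spans_mod M N g.

Lemma subspaceZ N a u : subspace N -> N u -> N (a *: u).
Proof. by move=> [N0 NZD] Nu; rewrite -[_ *: _]addr0; apply: NZD. Qed.

Lemma subspaceD N u v : subspace N -> N u -> N v -> N (u + v).
Proof. by move=> [_ NZD] Nu Nv; rewrite -[u]scale1r; apply: NZD. Qed.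

Lemma subspaceB N u v : subspace N -> N u -> N v -> N (u - v).
Proof. by move=> sN Nu Nv; rewrite -scaleN1r addrC; apply: sN.2. Qed.

Lemma subspace_sum N (I : finType) (c : I -> K) (u : I -> E) :
  subspace N -> (forall i, N (u i)) -> N (\sum_i c i *: u i).
Proof.
move=> sN Nu; elim/big_ind: _ => [|x y|i _]; first exact: sN.1.
  exact: subspaceD.
exact: subspaceZ.
Qed.

(** Expressing each [e i] modulo [N] through [g] gives a matrix with [d] rows and [#|I|] columns; if
    [d] were larger, a nonzero row vector in its left kernel would be a relation among the [e i]
    modulo [N]. *)
Lemma indep_le_spans M N d (e : 'I_d -> E) (I : finType) (g : I -> E) :
    subspace N -> (forall i, M (e i)) ->
    (forall c : 'I_d -> K, N (\sum_i c i *: e i) -> forall i, c i = 0) ->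
    spans_mod M N g ->
  (d <= #|I|)%N.
Proof.
move=> sN Me indep span.
have [A hA] := choice (fun i => span _ (Me i)).
rewrite leqNgt; apply/negP => ltId.
pose B : 'M[K]_(d, #|I|) := \matrix_(i, j) A i (enum_val j).
have : kermx B != 0.
  rewrite kermx_eq0 /row_free; apply/eqP => rkB.
  by have := rank_leq_col B; rewrite rkB leqNgt ltId.
case/rowV0Pn => v /sub_kermxP vB0 /eqP[]; apply/rowP => i; rewrite mxE.
apply: (indep (fun i => v 0 i)).
(* Since [v] kills [B], the contributions of the [g j] cancel, and each remaining difference lies in
   [N]. *)
suff -> : \sum_i v 0 i *: e i = \sum_i v 0 i *: (e i - \sum_j A i j *: g j).
  exact: subspace_sum.
under [RHS]eq_bigr => k _ do rewrite scalerBr scaler_sumr.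
rewrite sumrB exchange_big /= [X in _ - X]big1 ?subr0 // => j _.
under eq_bigr => k _ do rewrite scalerA.
rewrite -scaler_suml; have /rowP/(_ (enum_rank j)) := vB0.
rewrite !mxE; under eq_bigr => k _ do rewrite mxE enum_rankK.
by move=> ->; rewrite scale0r.
Qed.

(** An independent family of maximal length is a basis: lengths are bounded by the size of a
    spanning family, and a vector outside the span would extend the family. *)
Lemma quot_basis_exists M N : subspace N -> finite_dim_mod M N ->
  exists d (e : 'I_d -> E), quot_basis M N e.
Proof.
move=> sN [I [g span]].
pose indep d (e : 'I_d -> E) := (forall i, M (e i)) /\
  (forall c : 'I_d -> K, N (\sum_i c i *: e i) -> forall i, c i = 0).
pose P d := `[< exists e : 'I_d -> E, indep d e >].
have P0 : exists d, P d.
  by exists 0%N; apply/asboolP; exists (fun=> 0); split=> [|c _] [].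
have Pmax d : P d -> (d <= #|I|)%N.
  by case/asboolP => e [Me ie]; apply: indep_le_spans ie span.
case: (ex_maxnP P0 Pmax) => d /asboolP[e [Me ie]] dmax.
exists d, e; split=> // x Mx; apply: contrapT => nspan.
suff /dmax : P d.+1 by rewrite ltnn.
pose e' (i : 'I_d.+1) := if unlift ord0 i is Some j then e j else x.
apply/asboolP; exists e'; split=> [i|c].
  by rewrite /e'; case: unliftP.
rewrite big_ord_recl {1}/e' unlift_none.
under eq_bigr => i _ do rewrite /e' liftK.
(* Otherwise division by the coefficient of [x] would express [x] modulo [N] through [e]. *)
move=> Nc; have c0 : c ord0 = 0.
  apply: contra_notP nspan => /eqP c0.
  exists (fun i => - ((c ord0)^-1 * c (lift ord0 i))).
  have := subspaceZ (c ord0)^-1 sN Nc.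
  rewrite scalerDr scalerA mulVf // scale1r scaler_sumr.
  rewrite -sumrN; under eq_bigr => i _ do rewrite scalerA.
  by under [X in _ -> N (_ + X)]eq_bigr => i _ do rewrite scaleNr opprK.
move: Nc; rewrite c0 scale0r add0r => /(ie (fun i => c (lift ord0 i))) ci0 i.
by case: (unliftP ord0 i) => [j ->|->].
Qed.

(** Any two bases bound each other's length, so the value chosen by [xget] is forced. *)
Lemma quot_dim_eq M N d (e : 'I_d -> E) :
  subspace N -> quot_basis M N e -> quot_dim M N = d.
Proof.
move=> sN be; have [Me ie se] := be; apply: xget_unique; first by exists e.
move=> d' [e' [Me' ie' se']].
have := indep_le_spans sN Me ie se'; have := indep_le_spans sN Me' ie' se.
by rewrite !card_ord => dd' d'd; apply/eqP; rewrite eqn_leq dd'.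
Qed.

Lemma quot_dimP M N : subspace N -> finite_dim_mod M N ->
  exists e : 'I_(quot_dim M N) -> E, quot_basis M N e.
Proof.
move=> sN fMN; have [d [e be]] := quot_basis_exists sN fMN.
by rewrite (quot_dim_eq sN be); exists e.
Qed.

Lemma finite_dim_modS M M' N N' : M' `<=` M -> N `<=` N' ->
  finite_dim_mod M N -> finite_dim_mod M' N'.
Proof.
move=> MM NN [I [g span]]; exists I, g => x /MM/span[c Nc].
by exists c; apply: NN.
Qed.

(** A basis of [M / N] followed by a basis of [N / L] is a basis of [M / L]. *)
Lemma quot_dimD M N L : subspace N -> subspace L -> L `<=` N -> N `<=` M ->
  finite_dim_mod M L -> (quot_dim M L = quot_dim M N + quot_dim N L)%N.
Proof.
move=> sN sL LN NM fML.
have [e [Me ie se]] := quot_dimP sN (finite_dim_modS (@subset_refl _ M) LN fML).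
have [f [Nf jf sf]] := quot_dimP sL (finite_dim_modS NM (@subset_refl _ L) fML).
set a := quot_dim M N in e Me ie se *; set b := quot_dim N L in f Nf jf sf *.
pose ef (i : 'I_(a + b)) := match split i with inl j => e j | inr j => f j end.
have efl i : ef (lshift b i) = e i by rewrite /ef (unsplitK (inl i)).
have efr i : ef (rshift a i) = f i by rewrite /ef (unsplitK (inr i)).
have sum_ef (c : 'I_(a + b) -> K) : \sum_i c i *: ef i =
    \sum_i c (lshift b i) *: e i + \sum_i c (rshift a i) *: f i.
  rewrite big_split_ord /=; congr (_ + _); apply: eq_bigr => i _.
    by rewrite efl.
  by rewrite efr.
apply: (@quot_dim_eq M L _ ef sL); split=> [i|c|x Mx].
- by rewrite /ef; case: split => j; [|apply: NM].
- rewrite sum_ef => Lc.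
  (* The [f] part lies in [N], so the relation can first be read modulo [N], where only the [e i]
     remain. *)
  have ce i : c (lshift b i) = 0.
    apply: (ie (fun i => c (lshift b i))).
    rewrite -[X in N X](addrK (\sum_i c (rshift a i) *: f i)).
    by apply: subspaceB => //; [apply: LN|apply: subspace_sum].
  move: Lc; rewrite big1 ?add0r => [/(jf (fun i => c (rshift a i))) cf i|i _].
    by rewrite -(splitK i); case: (split i) => j /=.
  by rewrite ce scale0r.
- have [c Nc] := se x Mx; have [c' Lc'] := sf _ Nc.
  exists (fun i => match split i with inl j => c j | inr j => c' j end).
  rewrite sum_ef opprD addrA.
  under eq_bigr => i _ do rewrite (unsplitK (inl i)).
  by under [X in _ - _ - X]eq_bigr => i _ do rewrite (unsplitK (inr i)).
Qed.

End QuotientDimension.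

(* The hypotheses say that f induces an isomorphism M / N -> M' / N'. *)
Lemma quot_dim_iso (K : fieldType) (E E' : lmodType K) (f : {linear E -> E'})
    (M N : set E) (M' N' : set E') :
    subspace N -> subspace N' -> finite_dim_mod M N ->
    (forall x, M x -> M' (f x)) ->
    (forall y, M' y -> exists2 x, M x & N' (y - f x)) ->
    (forall x, N x <-> N' (f x)) ->
  quot_dim M' N' = quot_dim M N.
Proof.
move=> sN sN' fMN MM' surj NN'; have [e [Me ie se]] := quot_dimP sN fMN.
have fsum (c : _ -> K) : f (\sum_i c i *: e i) = \sum_i c i *: f (e i).
  by rewrite linear_sum; apply: eq_bigr => i _; rewrite linearZ.
apply: (@quot_dim_eq _ _ _ _ _ (f \o e) sN'); split=> [i|c|y M'y] /=.
- exact/MM'/Me.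
- by rewrite -fsum => /NN'/ie.
- have [x Mx N'x] := surj y M'y; have [c Nc] := se x Mx; exists c.
  rewrite -fsum -(subrK (f x) y) -addrA -linearB.
  by apply: subspaceD => //; apply/NN'.
Qed.

(** * Formal power series: monomial shifts and the geometric series *)

Section PowerSeries.
Variables (n : nat) (A : comNzRingType).
Implicit Types f g : fps n A.

Lemma fps_mulXE (q : 'X_{1..n}) g m :
  (fps_of_mpoly 'X_[q] * g) m = if (q <= m)%MM then g (m - q)%MM else 0.
Proof.
rewrite fpsME; case: ifPn => [le_qm|nle_qm]; last first.
  rewrite big1 // => -[k1 k2] /= /eqP e; rewrite mcoeffX.
  by case: eqP => [eqk|]; rewrite ?mul0r //; case/negP: nle_qm; rewrite e eqk lem_addr.
have lt_q : (mdeg q < (mdeg m).+1)%N by rewrite -(submK le_qm) mdegD ltnS leq_addl.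
have lt_mq : (mdeg (m - q)%MM < (mdeg m).+1)%N.
  by rewrite -[in X in (_ < X)%N](submK le_qm) mdegD ltnS leq_addr.
rewrite (bigD1 (BMultinom lt_q, BMultinom lt_mq)) /=; last by rewrite addmC submK.
rewrite mcoeffX eqxx mul1r big1 ?addr0 // => -[k1 k2] /= /andP[/eqP e nek].
rewrite mcoeffX; case: eqP => [eqk|]; rewrite ?mul0r //.
case/eqP: nek; congr pair; apply/val_inj => //=.
by rewrite (congr1 (fun k => (k - q)%MM) e) -eqk addmC addmK.
Qed.

Lemma fps_sumE (I : Type) (s : seq I) (P : pred I) (F : I -> fps n A) m :
  (\sum_(i <- s | P i) F i) m = \sum_(i <- s | P i) F i m.
Proof. by elim/big_rec2: _ => // i x y _ <-. Qed.

Lemma fps_mul_eq_low f f' g m : (forall k, (mdeg k <= mdeg m)%N -> f k = f' k) ->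
  (f * g) m = (f' * g) m.
Proof.
by move=> e; rewrite !fpsME; apply: eq_bigr => k _; rewrite e // -ltnS bmdeg.
Qed.

(** Each factor [g] has order at least 1, so the power has order at least [d]. *)
Lemma fps_expr_eq0 g d m : g 0%MM = 0 -> (mdeg m < d)%N -> (g ^+ d) m = 0.
Proof.
move=> g0; elim: d m => // d IHd m lt_md.
rewrite exprS fpsME big1 // => -[k1 k2] /= /eqP e.
have [k10|k10] := eqVneq (k1 : 'X_{1..n}) 0%MM; first by rewrite k10 g0 mul0r.
rewrite IHd ?mulr0 //; move: lt_md; rewrite {1}e mdegD.
by move: k10; rewrite -mdeg_eq0; lia.
Qed.

(** The inverse is the sum of all powers of [g]; its coefficient at [m] is already that of the
    partial sum of the powers below [(mdeg m).+1]. *)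
Lemma fps_geometric g : g 0%MM = 0 -> exists u : fps n A, (1 - g) * u = 1.
Proof.
move=> g0; pose s d := \sum_(k < d) g ^+ k.
have s_stable d k : (mdeg k < d)%N -> s d k = s (mdeg k).+1 k.
  elim: d => // d IHd; rewrite ltnS leq_eqVlt => /predU1P[<- //|lt_kd].
  have -> : s d.+1 = s d + g ^+ d by rewrite /s big_ord_recr.
  by rewrite fpsDE IHd // fps_expr_eq0 ?addr0.
exists (FPS (fun m => s (mdeg m).+1 m)); apply/fpsP => m.
(* The coefficient at [m] of a product only sees degrees up to [mdeg m], so the full series may be
   replaced by one partial sum, which telescopes. *)
rewrite mulrC (@fps_mul_eq_low _ (s (mdeg m).+1)) => [|k le_km /=]; last first.
  by rewrite -(s_stable (mdeg m).+1).
rewrite mulrC -opprB mulNr -subrX1 opprB.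
by rewrite fpsDE fpsNE fps_expr_eq0 // oppr0 addr0.
Qed.

End PowerSeries.

(** * Convergent power series: units and splitting off the variables *)

Section ConvergentSeries.
Variables (n : nat) (C : numFieldType).
Implicit Types f g : fps n C.

Lemma psumX_le (rho : C) d (q : 'X_{1..n}) : 0 <= rho ->
  psum rho d (fps_of_mpoly 'X_[q]) <= rho ^+ mdeg q.
Proof.
move=> rho0; have [lt_qd|le_dq] := ltnP (mdeg q) d.
  rewrite /psum (bigD1 (BMultinom lt_qd)) //= mcoeffX eqxx normr1 mul1r big1 ?addr0 //.
  move=> m ne_mq; rewrite /= mcoeffX; case: eqP => [e|]; rewrite ?normr0 ?mul0r //.
  by case/eqP: ne_mq; apply/val_inj.
rewrite /psum big1 ?exprn_ge0 // => m _; rewrite /= mcoeffX.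
case: eqP => [e|]; rewrite ?normr0 ?mul0r //.
by move: (bmdeg m); rewrite -e ltnNge le_dq.
Qed.

Lemma convergentX (q : 'X_{1..n}) : fps_of_mpoly 'X_[q] \in @convergent n C.
Proof.
apply/convergentP; exists 1; rewrite ?ltr01 //; exists 1 => d.
by rewrite -[leRHS](expr1n _ (mdeg q)) psumX_le ?ler01.
Qed.

(** Each nonconstant term is multiplied by a positive power of [t], which is at most [t]. *)
Lemma psum_contract (rho t : C) d g : 0 <= rho -> 0 <= t <= 1 -> g 0%MM = 0 ->
  psum (t * rho) d g <= t * psum rho d g.
Proof.
move=> rho0 /andP[t0 t1] g0; rewrite /psum mulr_sumr; apply: ler_sum => m _.
have [m0|m0] := eqVneq (m : 'X_{1..n}) 0%MM.
  by rewrite m0 g0 normr0 !mul0r mulr0.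
rewrite mulrCA ler_wpM2l // exprMn ler_wpM2r ?exprn_ge0 //.
move: m0; rewrite -mdeg_eq0; case: (mdeg m) => // k _.
by rewrite exprS ler_piMr // exprn_ile1.
Qed.

(** From $u = 1 + gu$, the partial sum [p] of [u] satisfies $p \le 1 + p/2$ on a polydisc so small
    that the partial sums of [g] stay below 1/2; hence $p \le 2$. *)
Lemma convergent_geometric g u : g \in @convergent n C -> g 0%MM = 0 ->
  (1 - g) * u = 1 -> u \in @convergent n C.
Proof.
move=> /convergentP[rho rho0 [B leB]] g0 gu.
have B0 : 0 <= B by apply: le_trans (leB 0%N); apply/psum_ge0/ltW.
(* The summand 1 keeps the denominator positive when [B] is 0 and ensures [t <= 1]; moreover $tB \le
   1/2$. *)
pose t := (2 * (B + 1))^-1.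
have B1 : 0 < B + 1 by rewrite ltr_wpDl ?ltr01.
have t0 : 0 < t by rewrite invr_gt0 mulr_gt0 ?ltr0n.
have t1 : t <= 1.
  rewrite invf_le1 ?mulr_gt0 ?ltr0n // -[leLHS]mulr1.
  by apply: ler_pM; rewrite ?ler01 ?ler1n // lerDr.
have tB : t * B <= 2^-1.
  rewrite /t invfM -mulrA ler_piMr ?invr_ge0 ?ler0n // mulrC ler_pdivrMr // mul1r.
  by rewrite lerDl ler01.
have trho : 0 <= t * rho by rewrite mulr_ge0 ?ltW.
apply/convergentP; exists (t * rho); rewrite ?mulr_gt0 //; exists 2 => d.
set p := psum _ _ u; have p0 : 0 <= p by apply: psum_ge0.
have : p <= 1 + 2^-1 * p.
  have eu : u = 1 + g * u by rewrite -[X in X + _]gu mulrBl mul1r subrK.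
  rewrite {1}/p [X in psum _ _ X]eu; apply: le_trans (psumD _ _ _ trho) _.
  have psum1 : psum (t * rho) d (1 : fps n C) <= 1.
    by have := psumX_le d 0%MM trho; rewrite mpolyX0 mdeg0 expr0.
  apply: lerD => //.
  apply: le_trans (psumM _ _ _ trho) _; apply: ler_wpM2r => //.
  apply: le_trans (psum_contract d (ltW rho0) _ g0) _; first by rewrite t1 ltW.
  by apply: le_trans (ler_wpM2l (ltW t0) (leB d)) tB.
rewrite -lerBlDr -{1}[p]mul1r -mulrBl.
have -> : 1 - 2^-1 = 2^-1 :> C.
  by rewrite {1}(splitr 1) !div1r addrK.
by rewrite -ler_pdivlMl ?invr_gt0 ?ltr0n // invrK mulr1.
Qed.

Lemma cps_unit (w : cps n C) : (w : fps n C) 0%MM = 0 ->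
  exists u : cps n C, (1 - w) * u = 1.
Proof.
move=> w0; have [u gu] := fps_geometric w0.
have cu := convergent_geometric (valP w) w0 gu.
by exists (CPS cu); apply/val_inj; rewrite rmorphM rmorphB rmorph1 /=.
Qed.

Definition cps_var (i : 'I_n) : cps n C := CPS (convergentX U_(i)%MM).

Definition first_var (m : 'X_{1..n}) (i : 'I_n) : bool :=
  (0 < m i)%N && [forall j : 'I_n, (j < i)%N ==> (m j == 0%N)].

(** The part of [f] supported on the monomials whose first variable is $x_i$, divided by $x_i$.
    Assigning each monomial to one variable avoids counting it twice. *)
Definition fps_div_var (i : 'I_n) f : fps n C :=
  FPS (fun m => if first_var (m + U_(i))%MM i then f (m + U_(i))%MM else 0).

(** Multiplication by $x_i$ raises degrees by one and is injective on monomials, so [rho] times a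
    partial sum of the quotient is at most the next partial sum of [f]. *)
Lemma convergent_div_var i f : f \in @convergent n C ->
  fps_div_var i f \in @convergent n C.
Proof.
move=> /convergentP[rho rho0 [B leB]]; apply/convergentP; exists rho => //.
exists (rho^-1 * B) => d; rewrite ler_pdivlMl //.
apply: le_trans (leB d.+1).
have lt_shift (m : 'X_{1..n < d}) : (mdeg (m + U_(i))%MM < d.+1)%N.
  by rewrite mdegD mdeg1 addn1 ltnS bmdeg.
pose shift m := BMultinom (lt_shift m).
have shift_inj : injective shift.
  move=> m1 m2 /(congr1 (fun k : 'X_{1..n < d.+1} => (k - U_(i))%MM)).
  by rewrite /= !addmK => /val_inj.
rewrite {2}/psum (bigID (mem [set shift m | m in [set: 'X_{1..n < d}]]%SET)) /=.
rewrite -[leLHS]addr0 lerD //; last first.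
  by apply: sumr_ge0 => m _; rewrite mulr_ge0 // exprn_ge0 // ltW.
rewrite big_imset; last by move=> ? ? _ _; apply: shift_inj.
rewrite /psum mulr_sumr [leRHS](eq_bigl xpredT) => [|m]; last by rewrite finset.in_setT.
apply: ler_sum => m _ /=; rewrite mdegD mdeg1 addn1 exprS [leLHS]mulrCA.
rewrite ler_wpM2r ?mulr_ge0 ?exprn_ge0 ?(ltW rho0) //.
by case: ifP => // _; rewrite normr0.
Qed.

Lemma first_varP (m : 'X_{1..n}) : m != 0%MM ->
  exists2 i, first_var m i & forall j, first_var m j -> j = i.
Proof.
move=> m0; have [i mi] : exists i, (0 < m i)%N.
  apply/existsP; apply: contraNT m0; rewrite negb_exists => /forallP m0.
  by apply/eqP/mnmP => i; have := m0 i; rewrite -eqn0Ngt mnm0E => /eqP.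
pose i0 := [arg min_(j < i | (0 < m j)%N) j].
have [fi0 i0_min] : (0 < m i0)%N /\ forall j, (0 < m j)%N -> (i0 <= j)%N.
  by rewrite /i0; case: arg_minnP.
have f_i0 : first_var m i0.
  rewrite /first_var fi0; apply/forallP => j; apply/implyP => lt_j.
  by rewrite -leqn0 leqNgt; apply/negP => /i0_min; rewrite leqNgt lt_j.
exists i0 => // j /andP[mj /forallP/(_ i0)].
have := i0_min j mj; rewrite leq_eqVlt => /predU1P[/val_inj //|->] /=.
by rewrite -leqn0 leqNgt fi0.
Qed.

(* Each nonconstant monomial is divided by its first variable. *)
Lemma cps_decomp (f : cps n C) : exists (c : C) (g : 'I_n -> cps n C),
  f = c *: 1 + \sum_i cps_var i * g i.
Proof.
exists ((f : fps n C) 0%MM), (fun i => CPS (convergent_div_var i (valP f))).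
apply/val_inj; rewrite rmorphD rmorph_sum; apply/fpsP => m; rewrite fpsDE fps_sumE.
set c := fcoef _ 0%MM; have -> : \val (c *: 1 : cps n C) m = c * (m == 0%MM)%:R.
  by rewrite /= mcoeff1.
have termE i : \val (cps_var i * CPS (convergent_div_var i (valP f))) m =
    if first_var m i then (f : fps n C) m else 0.
  rewrite rmorphM.
  transitivity ((fps_of_mpoly 'X_[U_(i)] * fps_div_var i f) m) => //.
  rewrite fps_mulXE /=; case: ifPn => [le_im|nle_im]; first by rewrite submK.
  rewrite ifN //; apply: contra nle_im => /andP[mi _]; apply/mnm_lepP => j.
  by rewrite mnm1E; case: eqP => [<-|].
under eq_bigr => i _ do rewrite termE.
have [->|m0] := eqVneq m 0%MM.
  by rewrite mulr1 big1 ?addr0 // => i _; rewrite /first_var mnm0E.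
rewrite mulr0 add0r; have [i fi i_uniq] := first_varP m0.
rewrite (bigD1 i) //= fi big1 ?addr0 // => j ne_ji.
by rewrite ifN //; apply: contra ne_ji => /i_uniq ->.
Qed.

End ConvergentSeries.

(** * The quotient map by a principal ideal *)

Lemma quot_map_linear (K : comNzRingType) (A : comAlgType K) (h : A) :
  linear (quot_map h).
Proof.
move=> c u v; rewrite /quot_map raddfD; congr (_ + _).
by symmetry; apply: pi_quot_scale; apply: principal_idealMl.
Qed.

HB.instance Definition _ (K : comNzRingType) (A : comAlgType K) (h : A) :=
  GRing.isLinear.Build K A (principal_quot h) _ (quot_map h) (@quot_map_linear K A h).

Lemma quot_map_eq (K : comNzRingType) (A : comAlgType K) (h u v : A) :
  quot_map h u = quot_map h v -> u - v \in principal_ideal h.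
Proof. by move=> /eqP; rewrite /quot_map -Quotient.idealrBE. Qed.

Lemma subspace_image (K : fieldType) (E E' : lmodType K) (f : {linear E -> E'})
  (N : set E) : subspace N -> subspace (f @` N).
Proof.
move=> [N0 NZD]; split=> [|a _ _ [u Nu <-] [v Nv <-]].
  by exists 0; rewrite ?linear0.
by exists (a *: u + v); [apply: NZD|rewrite linearP].
Qed.

(** * Valuation filtrations on the ring of germs and their colengths *)

Section Germs.
Variables (n : nat) (C : numFieldType) (J : prime_idealr (cps n C)).
Local Notation O := (germ_ring J).
Local Notation "g %:F" := (@FracField.tofrac O g).

Definition germ_of (f : cps n C) : O := \pi_({ideal_quot J})%qT f.

Lemma germ_ofD f g : germ_of (f + g) = germ_of f + germ_of g.
Proof. exact: raddfD. Qed.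

Lemma germ_ofM f g : germ_of (f * g) = germ_of f * germ_of g.
Proof. exact: rmorphM. Qed.

Lemma germ_of1 : germ_of 1 = 1.
Proof. exact: rmorph1. Qed.

Lemma germ_ofZ c f : germ_of (c *: f) = c *: germ_of f.
Proof. by symmetry; apply: pi_quot_scale => a u; apply: idealMr. Qed.

Lemma germ_of_sum (I : Type) (s : seq I) (F : I -> cps n C) :
  germ_of (\sum_(i <- s) F i) = \sum_(i <- s) germ_of (F i).
Proof. exact: raddf_sum. Qed.

Lemma germ_decomp (f : O) : exists (c : C) (g : 'I_n -> O),
  f = c *: 1 + \sum_i germ_of (cps_var C i) * g i.
Proof.
elim/quotW: f => f; have [c [g e]] := cps_decomp f.
exists c, (germ_of \o g); rewrite -/(germ_of f) {1}e germ_ofD germ_ofZ germ_of1.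
by rewrite germ_of_sum; under eq_bigr => i _ do rewrite germ_ofM.
Qed.

(** If [w] lifts an inverse, then $1 - w x_i$ lies in [J]; having constant term 1 it is a unit,
    although [J] is proper. *)
Lemma germ_var_nonunit i : germ_of (cps_var C i) \isn't a GRing.unit.
Proof.
apply/negP => /asboolP[y]; elim/quotW: y => w; rewrite -/(germ_of w).
rewrite -germ_ofM -germ_of1 => /esym/eqP; rewrite -Quotient.idealrBE => Jw.
have [|u wu] := @cps_unit n C (w * cps_var C i).
  rewrite [LHS](_ : _ = (fps_of_mpoly 'X_[U_(i)] * (w : fps n C)) 0%MM); last first.
    by rewrite mulrC.
  rewrite fps_mulXE ifN //; apply/negP => /mnm_lepP/(_ i).
  by rewrite mnm1E eqxx mnm0E.
by have := idealr1 J; rewrite -wu mulrC idealMr.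
Qed.

Variables (r : nat) (nu : 'I_r -> discrete_valuation {fraction O}).
Hypothesis nu_centred : forall j, centred_at_maximal_ideal (nu j).
Local Notation M := (valuation_filtration nu).
Implicit Types v w : 'I_r -> int.

Lemma subspace_valuation_filtration v : subspace (M v).
Proof.
split=> [j|c u w Mu Mw j]; first by rewrite rmorph0 dval0 leey.
rewrite rmorphD; apply: le_trans (dvalD _ _ _); rewrite le_min Mw andbT.
(* A scalar acts as multiplication by a constant germ, whose valuation is nonnegative. *)
rewrite -mulr_algl rmorphM dvalM; apply: le_trans (Mu j) _.
exact/leeDr/(nu_centred j).1.
Qed.

Lemma valuation_filtrationS v w : (forall j, w j <= v j) -> M v `<=` M w.
Proof. by move=> le_wv g Mg j; apply: le_trans (Mg j); rewrite lee_fin. Qed.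

Lemma valuation_filtration_nonpos v w :
  (forall j, v j = w j \/ (v j <= 0 /\ w j <= 0)) -> M v = M w.
Proof.
move=> vw; apply/seteqP; split=> g Mg j.
  case: (vw j) => [<- //|[_ w0]].
  by apply: le_trans (_ : 0 <= _)%E; [rewrite lee_fin|exact: (nu_centred j).1].
case: (vw j) => [-> //|[v0 _]].
by apply: le_trans (_ : 0 <= _)%E; [rewrite lee_fin|exact: (nu_centred j).1].
Qed.

Lemma germ_var_val j i : (1%:E <= nu j (germ_of (cps_var C i))%:F)%E.
Proof.
have : (0 < nu j (germ_of (cps_var C i))%:F)%E.
  exact/((nu_centred j).2 _).2/germ_var_nonunit.
by case: (nu j _) => [a||] //; rewrite lte_fin lee_fin -gtz0_ge1.
Qed.

(** Induction on [k]: writing $f = c + \sum_i x_i g_i$ and expanding each $g_i$ in a family [e]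
    spanning at level [k], the error is raised to level [k.+1] by $x_i$. So 1 and the products $x_i
    e_a$ span at the next level. *)
Lemma finite_dim_mod_const (k : nat) : finite_dim_mod [set: O] (M (fun=> k%:Z)).
Proof.
elim: k => [|k [I [e span]]].
  exists 'I_0, (fun=> 0) => x _; exists (fun=> 0) => j.
  by rewrite big_ord0 subr0; apply: (nu_centred j).1.
pose e' (a : unit + 'I_n * I) : O :=
  match a with inl _ => 1 | inr a => germ_of (cps_var C a.1) * e a.2 end.
exists (unit + 'I_n * I)%type, e' => f _.
have [c [g fE]] := germ_decomp f.
have [d hd] := choice (fun i => span (g i) Logic.I).
exists (fun a => match a with inl _ => c | inr a => d a.1 a.2 end).
rewrite big_sumType /= (big_pred1 tt) => [|[]//].
have -> : f - (c *: 1 + \sum_a d a.1 a.2 *: (germ_of (cps_var C a.1) * e a.2)) =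
    \sum_i 1 *: (germ_of (cps_var C i) * (g i - \sum_a d i a *: e a)).
  rewrite fE opprD addrACA subrr add0r.
  rewrite -(pair_bigA _ (fun i a => d i a *: (germ_of (cps_var C i) * e a))) /=.
  rewrite -sumrB; apply: eq_bigr => i _; rewrite scale1r mulrBr; congr (_ - _).
  by rewrite mulr_sumr; apply: eq_bigr => a _; rewrite scalerAr.
apply: subspace_sum => [|i j]; first exact: subspace_valuation_filtration.
rewrite rmorphM dvalM -[k.+1]add1n PoszD EFinD.
by apply: leeD; [exact: germ_var_val|exact: hd].
Qed.

Lemma finite_dim_valuation_filtration v : finite_dim_mod [set: O] (M v).
Proof.
(* The sum of the absolute values is a constant bounding every [v j]. *)
apply: finite_dim_modS (finite_dim_mod_const (\sum_j `|v j|)%N) => //.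
apply: valuation_filtrationS => j; rewrite (bigD1 j) //= PoszD abszE.
by apply: ler_wpDr => //; exact: ler_norm.
Qed.

Definition colength v := quot_dim [set: O] (M v).

Lemma dim_series_colength v : dim_series M v =
  (colength (fun j => v j + 1))%:Z - (colength v)%:Z.
Proof.
apply/eqP; rewrite eq_sym subr_eq addrC /dim_series -PoszD; apply/eqP; congr Posz.
apply: quot_dimD => //; try exact: subspace_valuation_filtration.
  by apply: valuation_filtrationS => j; rewrite lerDl.
exact: finite_dim_valuation_filtration.
Qed.

(** Strict negativity makes both [v j] and [v j + 1] nonpositive, so the conditions at [j] are void
    for both spaces and remain void after lowering [v j]. *)
Lemma dim_series_neg v j : v j < 0 ->
  dim_series M v = dim_series M (fun i => v i - (U_(j)%MM i)%:Z).
Proof.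
move=> vj; rewrite /dim_series; congr (Posz (quot_dim _ _));
  apply: valuation_filtration_nonpos => i;
  rewrite mnm1E; case: eqP => [<-|_] /=; rewrite ?subr0; by [left|right; lia].
Qed.

(** * The principal ideal and the embedded filtration *)

Variable h : O.
Hypothesis h_neq0 : h != 0.
Local Notation q := (valuation_exponent nu h).

(** As [h] is nonzero its valuations are finite, and they are nonnegative by centredness, so [fine]
    and the absolute value lose nothing. *)
Lemma val_exponentE j : nu j h%:F = (q j)%:Z%:E.
Proof.
have fin_h : nu j h%:F \is a fin_num by apply: dval_fin; rewrite tofrac_eq0.
rewrite mnmE -[LHS](fineK fin_h); congr EFin.
rewrite abszE ger0_norm // -lee_fin fineK //; exact: (nu_centred j).1.
Qed.

(** The full preimage in [O] of the embedded filtration, so that dimensions can be compared inside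
    [O]. *)
Definition sum_filtration v : set O :=
  [set g + a | g in M v & a in [set` principal_ideal h]].

Lemma subspace_sum_filtration v : subspace (sum_filtration v).
Proof.
have [M0 MZD] := subspace_valuation_filtration v.
split=> [|c _ _ [g Mg [a ha <-]] [g' Mg' [a' ha' <-]]].
  by exists 0 => //; exists 0; rewrite ?addr0 //=; exact: rpred0.
exists (c *: g + g'); first exact: MZD.
exists (c *: a + a'); last by rewrite scalerDr addrACA.
by rewrite /= rpredD // -mulr_algl principal_idealMl.
Qed.

Lemma sub_sum_filtration v : M v `<=` sum_filtration v.
Proof. by move=> g Mg; exists g => //; exists 0; rewrite ?addr0 //=; exact: rpred0. Qed.

Lemma sum_filtrationS v w : (forall j, w j <= v j) ->
  sum_filtration v `<=` sum_filtration w.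
Proof.
move=> le_wv _ [g Mg [a ha <-]]; exists g; first exact: valuation_filtrationS Mg.
by exists a.
Qed.

Lemma finite_dim_sum_filtration v : finite_dim_mod [set: O] (sum_filtration v).
Proof.
apply: finite_dim_modS (finite_dim_valuation_filtration v) => //.
exact: sub_sum_filtration.
Qed.

Lemma valuation_filtration_mul v x :
  M (fun j => v j - (q j)%:Z) x <-> M v (x * h).
Proof.
have E j : ((v j - (q j)%:Z)%:E <= nu j x%:F)%E = ((v j)%:E <= nu j (x * h)%:F)%E.
  rewrite rmorphM dvalM val_exponentE.
  by case: (nu j _) => [a||] //=; rewrite ?leey // -EFinD !lee_fin lerBlDr.
by split=> Mx j; [rewrite -E|rewrite E]; exact: Mx.
Qed.

Lemma colength_sum_filtration v : (colength v =
  quot_dim [set: O] (sum_filtration v) + colength (fun j => v j - (q j)%:Z)%R)%N.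
Proof.
rewrite /colength (quot_dimD (subspace_sum_filtration v)) //; first last.
- exact: finite_dim_valuation_filtration.
- exact: sub_sum_filtration.
- exact: subspace_valuation_filtration.
congr (_ + _)%N.
(* Multiplication by [h] maps [O] onto the sum modulo [M v], with kernel [M] at [v - q]. *)
apply: (@quot_dim_iso _ _ _ (h \o* idfun : {linear O -> O})).
- exact: subspace_valuation_filtration.
- exact: subspace_valuation_filtration.
- exact: finite_dim_valuation_filtration.
- move=> x _; exists 0; first exact: (subspace_valuation_filtration v).1.
  by exists (x * h); rewrite ?add0r //=; apply/asboolP; exists x.
- move=> _ [g Mg [_ /asboolP[x ->] <-]]; exists x => //=.
  by rewrite addrK.
- exact: valuation_filtration_mul.
Qed.

(** Both sums contain the kernel of the quotient map, so passing to the quotient ring preserves the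
    dimension between them; additivity in [O] then gives the difference. *)
Lemma dim_series_embedded v : dim_series (embedded_filtration nu h) v =
  (quot_dim [set: O] (sum_filtration (fun j => v j + 1)))%:Z
  - (quot_dim [set: O] (sum_filtration v))%:Z.
Proof.
set v1 := fun j => v j + 1.
have le_v : sum_filtration v1 `<=` sum_filtration v.
  by apply: sum_filtrationS => j; rewrite lerDl.
have -> : dim_series (embedded_filtration nu h) v =
    (quot_dim (sum_filtration v) (sum_filtration v1))%:Z.
  congr Posz.
  apply: (@quot_dim_iso _ _ _ (quot_map h : {linear O -> principal_quot h})).
  - exact: subspace_sum_filtration.
  - exact/subspace_image/subspace_sum_filtration.
  - exact: finite_dim_modS (finite_dim_sum_filtration v1).
  - by move=> x Mx; exists x.
  - move=> _ [x Mx <-]; exists x => //; rewrite subrr.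
    exact: (subspace_image _ (subspace_sum_filtration v1)).1.
  - move=> x; split=> [Mx|[_ [g Mg [a ha <-]] /esym/quot_map_eq hx]]; first by exists x.
    exists g => //; exists (x - g); last by rewrite addrC subrK.
    by rewrite /= -[x - g](subrK a) -[x - g - a]addrA -opprD rpredD.
apply/eqP; rewrite eq_sym subr_eq addrC -PoszD; apply/eqP; congr Posz.
apply: quot_dimD => //; try exact: subspace_sum_filtration.
exact: finite_dim_sum_filtration.
Qed.

Lemma dim_series_embedded_shift v : dim_series (embedded_filtration nu h) v =
  dim_series M v - dim_series M (fun j => v j - (q j)%:Z).
Proof.
rewrite dim_series_embedded !dim_series_colength.
rewrite (colength_sum_filtration v) (colength_sum_filtration (fun j => v j + 1)).
have -> : (fun j => v j + 1 - (q j)%:Z) = (fun j => v j - (q j)%:Z + 1).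
  by apply/funext => j; rewrite addrAC.
by rewrite !PoszD; lia.
Qed.

End Germs.

(** * Bilateral series as a module over polynomials *)

Section BilateralSeries.
Variable r : nat.
Implicit Types (p : {mpoly int[r]}) (L : ('I_r -> int) -> int) (v : 'I_r -> int).

(** An index set independent of the support lets several polynomials be summed together. *)
Lemma bilateral_scalewE p L v k : (msize p <= k)%N ->
  bilateral_scale p L v =
  \sum_(m : 'X_{1..r < k}) p@_m * L (fun j => v j - (m j)%:Z).
Proof.
move=> le_pk; rewrite /bilateral_scale (big_mksub 'X_{1..r < k}) ?msupp_uniq //=.
  by rewrite big_rmcond //= => m /memN_msupp_eq0 ->; rewrite mul0r.
by move=> m m_p; apply: leq_trans (msize_mdeg_lt m_p) le_pk.
Qed.

Lemma bilateral_scaleB p1 p2 L v : bilateral_scale (p1 - p2) L v =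
  bilateral_scale p1 L v - bilateral_scale p2 L v.
Proof.
pose k := maxn (msize p1) (msize p2).
have le_k : (msize (p1 - p2) <= k)%N.
  by apply: leq_trans (msizeD_le _ _) _; rewrite msizeN.
rewrite !(@bilateral_scalewE _ _ _ k) ?leq_maxl ?leq_maxr // -sumrB.
by apply: eq_bigr => m _; rewrite mcoeffB mulrBl.
Qed.

Lemma bilateral_scaleMX p q L v : bilateral_scale (p * 'X_[q]) L v =
  bilateral_scale p (fun w => L (fun j => w j - (q j)%:Z)) v.
Proof.
rewrite /bilateral_scale (perm_big _ (msuppMX p q)) big_map; apply: eq_bigr => m _.
rewrite mcoeffMX; congr (_ * L _); apply/funext => j.
by rewrite mnmDE addnC PoszD opprD addrA.
Qed.

Lemma bilateral_scale_sub p L1 L2 v :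
  bilateral_scale p (fun w => L1 w - L2 w) v =
  bilateral_scale p L1 v - bilateral_scale p L2 v.
Proof. by rewrite /bilateral_scale -sumrB; apply: eq_bigr => m _; rewrite mulrBr. Qed.

Lemma bilateral_scale_shift p q L v :
  bilateral_scale p (fun w => L (fun j => w j - (q j)%:Z)) v =
  bilateral_scale p L (fun j => v j - (q j)%:Z).
Proof.
apply: eq_bigr => m _; congr (_ * L _); apply/funext => j.
by rewrite addrAC.
Qed.

(** The factor $t_j - 1$ turns [L] into a difference in direction [j], which vanishes where the
    [j]-th coordinate is negative. *)
Lemma bilateral_scale_neg L v j :
    (forall w, w j < 0 -> L w = L (fun i => w i - (U_(j)%MM i)%:Z)) ->
  v j < 0 -> bilateral_scale (\prod_(i < r) ('X_i - 1)) L v = 0.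
Proof.
move=> Lj vj; rewrite (bigD1 j) //= mulrC mulrBr mulr1 bilateral_scaleB.
rewrite bilateral_scaleMX -bilateral_scale_sub /bilateral_scale big1 // => m _.
(* The remaining monomials only lower the [j]-th coordinate, so it stays negative. *)
rewrite -Lj ?subrr ?mulr0 //; apply: le_lt_trans vj.
by rewrite gerBl.
Qed.

End BilateralSeries.

(** * Comparison of the two Poincaré series *)

Theorem theorem1 (R : realType) (n : nat) (J : prime_idealr (cps n R[i]))
    (h : germ_ring J) (r : nat)
    (nu : 'I_r -> discrete_valuation {fraction germ_ring J}) :
  h != 0 -> (0 < r)%N -> (forall j, centred_at_maximal_ideal (nu j)) ->
  poincare_series (embedded_filtration nu h) =
    (1 - fps_of_mpoly 'X_[valuation_exponent nu h])
      * poincare_series (valuation_filtration nu).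
Proof.
(* Both sides share the denominator, so the numerators are compared coefficientwise. *)
move=> h0 _ nuC; rewrite /poincare_series mulrA; congr (_ / _).
apply/fpsP => m; rewrite mulrBl mul1r fpsDE fpsNE fps_mulXE /=.
rewrite (_ : dim_series _ = fun v => dim_series (valuation_filtration nu) v -
  dim_series (valuation_filtration nu)
    (fun j => v j - (valuation_exponent nu h j)%:Z)); last first.
  by apply/funext => v; exact: dim_series_embedded_shift.
rewrite bilateral_scale_sub bilateral_scale_shift; congr (_ - _).
case: ifPn => [/mnm_lepP le_qm|nle_qm].
  by congr bilateral_scale; apply/funext => j; rewrite mnmBE subzn.
(* Here the power series product contributes 0, and so does the bilateral numerator, since $m - q$
   has a negative coordinate. *)
have [j lt_mq] : exists j, (m j < valuation_exponent nu h j)%N.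
  apply/existsP; apply: contraNT nle_qm; rewrite negb_exists => /forallP le_qm.
  by apply/mnm_lepP => j; rewrite leqNgt.
apply: (@bilateral_scale_neg _ _ _ j) => [w|]; first exact: (dim_series_neg nuC).
by rewrite subr_lt0.
Qed.
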